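(* There exists a polynomial $f \in \mathbb{R}[x,y]$ of degree $4$ whose hessian curve $\{(x,y) \in \mathbb{R}^2 : \mathrm{Hess}(f)(x,y) = 0\}$ is smooth, compact, and consists of exactly four ovals.
   Context: For $f \in \mathbb{R}[x,y]$, the hessian of $f$ is $\mathrm{Hess}(f) = f_{xx}f_{yy} - f_{xy}^2$, where subscripts denote partial derivatives. The hessian curve of $f$ is the curve in $\mathbb{R}^2$ defined by $\mathrm{Hess}(f) = 0$. The curve is smooth if the gradient of the defining polynomial $\mathrm{Hess}(f)$ does not vanish at any point of the curve. An oval is a bounded (compact) connected component of the curve in $\mathbb{R}^2$; thus ''consists of exactly four ovals'' means that the curve has exactly four connected components, all of them compact. *)

(* Defs.v *)
(* The notations of mpoly clash with those of MathComp-Analysis, hence the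
   qualified names mpoly.msize etc. *)
From mathcomp Require Import all_boot all_order all_algebra.
From mathcomp Require Import all_classical all_reals all_analysis.
From mathcomp Require Import -(notations) mpoly.

Set Implicit Arguments.
Unset Strict Implicit.
Unset Printing Implicit Defensive.

Import Order.TTheory GRing.Theory Num.Theory.
Import numFieldNormedType.Exports.

Local Open Scope classical_set_scope.
Local Open Scope ring_scope.

Notation bipoly R := (mpoly.mpoly 2 R).

(* The variables of index 0 and 1 are x and y. *)
Definition dx (R : realType) (f : bipoly R) : bipoly R :=
  mpoly.mderiv (ord0 : 'I_2) f.

Definition dy (R : realType) (f : bipoly R) : bipoly R :=
  mpoly.mderiv (ord_max : 'I_2) f.

Definition eval_at (R : realType) (f : bipoly R) (p : R * R) : R :=
  mpoly.meval (fun i : 'I_2 => if i == ord0 then p.1 else p.2) f.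

(* mpoly.msize is one more than the total degree, and 0 for the zero
   polynomial. *)
Definition has_degree (R : realType) (f : bipoly R) (d : nat) : Prop :=
  mpoly.msize f = d.+1.

Definition Hess (R : realType) (f : bipoly R) : bipoly R :=
  dx (dx f) * dy (dy f) - dy (dx f) ^+ 2.

Definition curve (R : realType) (g : bipoly R) : set (R * R) :=
  [set p | eval_at g p = 0].

Definition gradient (R : realType) (g : bipoly R) (p : R * R) : R * R :=
  (eval_at (dx g) p, eval_at (dy g) p).

(* Smoothness is a property of the defining polynomial, not only of its zero
   set. *)
Definition smooth_curve (R : realType) (g : bipoly R) : Prop :=
  forall p : R * R, curve g p -> gradient g p <> (0, 0).

Definition components (T : topologicalType) (A : set T) : set (set T) :=
  [set connected_component A x | x in A].

Definition oval (R : realType) (A K : set (R * R)) : Prop :=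
  components A K /\ compact K.

Definition consists_of_ovals (R : realType) (A : set (R * R)) (n : nat) : Prop :=
  (components A #= `I_n)%card /\ (forall K, components A K -> oval A K).

(* Main.v *)
(* A quartic f that is even in y has a hessian that is quadratic in y^2.  Up to
   scaling, take f = y^4/6 - y^2 (x^2 + 1) + g(x) with g'' = H quadratic; then
     Hess f = (disc(x) - (4 y^2 - mid(x))^2) / 4,
   where mid = H - 6 x^2 + 2 and mid^2 - disc = 8 (x^2 + 1) H.  If H > 0 and disc
   is positive exactly on two bounded intervals, on which mid > 0, then over each
   of them the curve is y = +- sqrt((mid +- sqrt disc) / 4): two ovals exchanged
   by y -> -y, both avoiding the x-axis.  Smoothness is the simplicity of the
   roots of disc.
   Since disc = (H - 10 x^2 - 2)^2 - 64 x^2 (x^2 + 1), the substitution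
   x = (w - 1/w) / 2 gives
     disc = (H - (w - 3/w)^2 / 2) (H - (3 w - 1/w)^2 / 2),
   so H can be chosen to make the four roots of disc rational; here
   540 H = 7128 x^2 - 6324 x + 1465, and denominators have been cleared. *)

Require Import Defs.
From mathcomp Require Import all_boot all_order all_algebra.
From mathcomp Require Import all_classical all_reals all_analysis.
From mathcomp Require Import -(notations) mpoly.
From mathcomp Require Import ring lra.
Import numFieldNormedType.Exports.

Set Implicit Arguments.
Unset Strict Implicit.
Unset Printing Implicit Defensive.

Import Order.TTheory GRing.Theory Num.Theory.

Local Open Scope classical_set_scope.
Local Open Scope ring_scope.

(** * Connected components of a finite disjoint union of closed connected sets *)

Section FiniteClosedPartition.
Context (T : topologicalType) (I : choiceType) (D : set I) (K : I -> set T).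
Hypotheses (finD : finite_set D) (K0 : forall i, D i -> K i !=set0).
Hypotheses (Kconn : forall i, D i -> connected (K i)).
Hypotheses (Kclosed : forall i, D i -> closed (K i)).
Hypothesis Kdisj : trivIset D K.

(** By finiteness the union [L] of the other pieces is closed, so [K i] cuts out of the component
    [C] a part that is both closed and open in [C]; being nonempty, it is all of [C]. *)
Lemma connected_component_bigcup i x : D i -> K i x ->
  connected_component (\bigcup_(j in D) K j) x = K i.
Proof.
move=> Di Kix; apply/seteqP; split; last first.
  by apply: connected_component_max => //; [exact: bigcup_sup|exact: Kconn].
set C := connected_component _ _.
have CU : C `<=` \bigcup_(j in D) K j by exact: connected_component_sub.
have Cx : C x by apply: connected_component_refl; exists i.
set L := \bigcup_(j in D `\ i) K j.
have Lclosed : closed L.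
  apply: closed_bigcup => [|j [Dj _]]; last exact: Kclosed.
  exact: sub_finite_set finD.
have CKL : C `&` K i = C `&` ~` L.
  apply/seteqP; split=> y [Cy].
    move=> Ky; split=> // -[j [Dj nji] Kjy]; apply: nji.
    by apply: Kdisj => //; exists y.
  move=> nLy; split=> //; have [j Dj Kjy] := CU _ Cy.
  have [<-//|nji] := pselect (j = i).
  by exfalso; apply: nLy; exists j.
suff CK : C `&` K i = C by move=> y; rewrite -CK => -[].
apply: (@component_connected _ (\bigcup_(j in D) K j) x); first by exists x.
- by exists (~` L) => //; exact: closed_openC.
- by exists (K i) => //; exact: Kclosed.
Qed.

Lemma components_bigcup : components (\bigcup_(j in D) K j) = K @` D.
Proof.
apply/seteqP; split=> [_ [x [i Di Kix] <-]|_ [i Di <-]].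
  by exists i; rewrite // (connected_component_bigcup Di).
have [x Kix] := K0 Di.
by exists x; [exists i|exact: connected_component_bigcup].
Qed.

Lemma card_components_bigcup : (components (\bigcup_(j in D) K j) #= D)%card.
Proof.
rewrite components_bigcup; apply: inj_card_eq => i j.
rewrite !inE => Di Dj Kij; apply: Kdisj => //.
by rewrite Kij setIid; exact: K0.
Qed.

End FiniteClosedPartition.

(** * The real geometry of the quartic curve: four disjoint compact ovals *)

Section OvalGeometry.
Context (R : realType).
Implicit Types (x s t : R) (p : R * R) (i : nat).

(** This is 540 times, and [disc] 540^2 times, the function of the same name in the overview. The
    roots of [disc] are (w - 1/w) / 2 for w = 2/9, 28/27, 4/3, 3/2. *)
Definition mid x : R := 3888 * x ^+ 2 - 6324 * x + 2545.

Definition disc x : R :=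
  - ((36 * x + 77) * (1512 * x - 55) * (24 * x - 7) * (12 * x - 5)).

Definition quartic : set (R * R) :=
  [set p | (2160 * p.2 ^+ 2 - mid p.1) ^+ 2 = disc p.1].

Definition left_end i : R := if (i < 2)%N then - (77 / 36) else 7 / 24.
Definition right_end i : R := if (i < 2)%N then 55 / 1512 else 5 / 12.

Lemma disc_ge0 x : 0 <= disc x <->
  (left_end 0 <= x <= right_end 0 \/ left_end 2 <= x <= right_end 2).
Proof.
have e0 : (left_end 0 <= x <= right_end 0) =
    (0 <= 36 * x + 77) && (1512 * x - 55 <= 0).
  by rewrite /left_end /right_end /=; apply/andP/andP; case; split; lra.
have e2 : (left_end 2 <= x <= right_end 2) =
    (0 <= 24 * x - 7) && (12 * x - 5 <= 0).
  by rewrite /left_end /right_end /=; apply/andP/andP; case; split; lra.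
(* The factors are increasing and listed by increasing root. These implications record that order,
   and the sign analysis then treats the factors as abstract [u v w z]. *)
have uv : 36 * x + 77 < 0 -> 1512 * x - 55 < 0 by lra.
have vu : 0 < 1512 * x - 55 -> 0 < 36 * x + 77 by lra.
have vw : 1512 * x - 55 <= 0 -> 24 * x - 7 < 0 by lra.
have wz : 24 * x - 7 < 0 -> 12 * x - 5 < 0 by lra.
have zw : 0 < 12 * x - 5 -> 0 < 24 * x - 7 by lra.
rewrite e0 e2 /disc oppr_ge0 => {e0 e2}; move: uv vu vw wz zw.
move: (36 * x + 77) (1512 * x - 55) (24 * x - 7) (12 * x - 5).
move=> u v w z uv vu vw wz zw.
have [u0|u0] /= := ltP u 0.
  have v0 := uv u0; have w0 := vw (ltW v0); have z0 := wz w0.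
  rewrite leNgt nmulr_lgt0 // pmulr_rlt0 ?nmulr_lgt0 // w0 leNgt w0.
  by split=> // -[].
have [v0|v0] /= := leP v 0.
  have w0 := vw v0; have z0 := wz w0; split=> _; first by left.
  rewrite mulr_ge0_le0 ?(ltW z0) // mulr_le0 ?(ltW w0) //.
  exact: mulr_ge0_le0.
have [w0|w0] /= := ltP w 0.
  have z0 := wz w0.
  rewrite leNgt nmulr_lgt0 // pmulr_rlt0 ?mulr_gt0 ?vu // w0.
  by split=> // -[].
have [z0|z0] := leP z 0.
  split=> _; first by right.
  by rewrite mulr_ge0_le0 // mulr_ge0 // mulr_ge0 // ltW.
by rewrite leNgt !mulr_gt0 ?vu ?zw //; split=> // -[].
Qed.

(** Hence both candidate values ([mid] ± sqrt [disc]) / 2160 of y^2 are positive, which keeps the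
    curve off the x-axis. *)
Lemma sqrt_disc_lt x : 0 <= disc x -> Num.sqrt (disc x) < mid x.
Proof.
(* [mid] takes negative values further to the right, so its positivity has to come from x <= 5/12,
   by expansion around that point. *)
move=> d0; have x_le : x <= 5 / 12.
  by move: d0 => /disc_ge0; rewrite /left_end /right_end /= => -[] /andP[_]; lra.
have q0 : 0 < mid x.
  have -> : mid x = 3888 * (x - 5 / 12) ^+ 2 + 3084 * (5 / 12 - x) + 585.
    by rewrite /mid; field.
  have := sqr_ge0 (x - 5 / 12); lra.
have disc_lt : disc x < mid x ^+ 2.
  rewrite -subr_gt0.
  (* This is the rescaled 8 (x^2 + 1) H, with the square completed in H to show H > 0. *)
  have -> : mid x ^+ 2 - disc x =
      4320 * ((x ^+ 2 + 1) * (7128 * (x - 3162 / 7128) ^+ 2 + 12341 / 198)).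
    by rewrite /mid /disc; field.
  have := sqr_ge0 x; have := sqr_ge0 (x - 3162 / 7128).
  move: (_ ^+ 2) (x ^+ 2) => s t s0 t0.
  have : 0 < (t + 1) * (7128 * s + 12341 / 198) by rewrite mulr_gt0; lra.
  lra.
have := disc_lt; rewrite -(ltr_sqrt (disc x)); last by rewrite exprn_gt0.
by rewrite sqrtr_sqr gtr0_norm.
Qed.

(* For i < 4, the test i < 2 selects the interval and the parity of i the
   half-plane. *)
Definition oval_piece i : set (R * R) :=
  [set p | [/\ quartic p, left_end i <= p.1 <= right_end i &
               0 < (-1) ^+ i * p.2]].

(** For [t] = 1 and [t] = -1, these are the arcs of an oval farther from and nearer to the
    x-axis. *)
Definition branch i t x : R * R :=
  (x, (-1) ^+ i * Num.sqrt ((mid x + t * Num.sqrt (disc x)) / 2160)).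

(** [Num.sqrt] is 0 on negative reals, hence continuous everywhere, and the arcs extend continuously
    to the whole line. *)
Lemma branch_continuous i t : continuous (branch i t).
Proof.
have qc : continuous mid.
  move=> x; apply: cvgD; last exact: cvg_cst.
  apply: cvgB; apply: cvgM; try exact: cvg_cst; last exact: cvg_id.
  exact: exprn_continuous.
have lin (a b : R) : continuous (fun x : R => a * x + b).
  move=> x; apply: cvgD; last exact: cvg_cst.
  by apply: cvgM; [exact: cvg_cst|exact: cvg_id].
have dc : continuous disc.
  move=> x; apply: cvgN.
  by apply: cvgM; [apply: cvgM; [apply: cvgM|]|]; exact: lin.
have sqrtc (g : R -> R) : continuous g -> continuous (fun x => Num.sqrt (g x)).
  move=> gc x.
  exact: (@continuous_comp _ _ _ g Num.sqrt x (gc x) (@sqrt_continuous _ _)).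
have bc : continuous (fun x => (branch i t x).2).
  move=> x; apply: cvgM; first exact: cvg_cst.
  apply: (sqrtc (fun x => (mid x + t * Num.sqrt (disc x)) / 2160)) => {}x.
  apply: cvgM; last exact: cvg_cst.
  apply: cvgD; first exact: qc.
  by apply: cvgM; [exact: cvg_cst|exact: sqrtc].
move=> x; have xx : y @[y --> x] --> x by exact: cvg_id.
exact: (cvg_pair xx (bc x)).
Qed.

Lemma branch_mem i t x : t ^+ 2 = 1 -> 0 <= disc x ->
  left_end i <= x <= right_end i -> oval_piece i (branch i t x).
Proof.
move=> t1 d0 xi; rewrite /oval_piece /quartic /branch /=.
have c0 : 0 < 2160 :> R by lra.
have := sqrt_disc_lt d0; move: (2160 : R) c0 => c c0.
have := sqr_sqrtr d0; have := sqrtr_ge0 (disc x).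
move: (mid x) (disc x) (Num.sqrt (disc x)) => m d s s0 sd sm.
have r0 : 0 < (m + t * s) / c.
  apply: divr_gt0 c0; have := ler_norm (- (t * s)).
  have -> : `|- (t * s)| = s; last by lra.
  rewrite normrN; have /eqP := t1; rewrite sqrf_eq1 => /orP[] /eqP ->.
    by rewrite mul1r ger0_norm.
  by rewrite mulN1r normrN ger0_norm.
split=> //; last by rewrite mulrA -expr2 sqrr_sign mul1r sqrtr_gt0.
rewrite exprMn sqrr_sign mul1r sqr_sqrtr ?ltW // mulrC divfK ?gt_eqF //.
by rewrite addrC addKr exprMn t1 mul1r.
Qed.

(** Taking roots in the equation gives 2160 y^2 = [mid] ± sqrt [disc], and the parity of [i] fixes
    the sign of y. *)
Lemma oval_piece_branches i : (i < 4)%N -> oval_piece i =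
  branch i 1 @` `[left_end i, right_end i] `|`
  branch i (-1) @` `[left_end i, right_end i].
Proof.
move=> i4; have disc_ge0_i x : left_end i <= x <= right_end i -> 0 <= disc x.
  by move=> xi; apply/disc_ge0; move: i i4 xi => [|[|[|[]]]] //; [left|left|right|right].
apply/seteqP; split; last first.
  move=> p; rewrite /= => -[[x]|[x]]; rewrite in_itv /= => xi <-.
    by apply: (branch_mem _ _ xi); [rewrite expr1n|exact: disc_ge0_i].
  by apply: (branch_mem _ _ xi); [rewrite sqrrN expr1n|exact: disc_ge0_i].
move=> [x y] [/= eq_xy xi y0].
have d0 : 0 <= disc x by exact: disc_ge0_i.
have sd : Num.sqrt (disc x) ^+ 2 = disc x by rewrite sqr_sqrtr.
have y_norm : `|y| = (-1) ^+ i * y.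
  by rewrite -[RHS](gtr0_norm y0) normrM normr_sign mul1r.
have yE : y = (-1) ^+ i * Num.sqrt (y ^+ 2).
  by rewrite sqrtr_sqr y_norm mulrA -expr2 sqrr_sign mul1r.
have /eqP : (2160 * y ^+ 2 - mid x) ^+ 2 = Num.sqrt (disc x) ^+ 2 by rewrite sd.
rewrite eqf_sqr => /orP[] /eqP yeq; [left|right]; exists x;
  rewrite /= ?in_itv //= /branch; congr pair; rewrite [RHS]yE; congr (_ * Num.sqrt _);
  move: yeq; move: (Num.sqrt _) (y ^+ 2) => s t; lra.
Qed.

Lemma left_lt_right i : left_end i < right_end i.
Proof. by rewrite /left_end /right_end; case: ifP => _; lra. Qed.

Lemma disc_left_end i : disc (left_end i) = 0.
Proof. by rewrite /disc /left_end; case: ifP => _; field. Qed.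

Lemma branch_left_end i s t : branch i s (left_end i) = branch i t (left_end i).
Proof. by rewrite /branch disc_left_end sqrtr0 !mulr0. Qed.

Lemma left_end_mem i : left_end i \in `[left_end i, right_end i].
Proof. by rewrite in_itv /= lexx (ltW (left_lt_right i)). Qed.

(** The two arcs are continuous images of a segment and meet over its left end, where [disc]
    vanishes. *)
Lemma oval_piece_connected i : (i < 4)%N -> connected (oval_piece i).
Proof.
move=> i4; rewrite (oval_piece_branches i4); apply: connectedU.
- exists (branch i 1 (left_end i)); split.
    by exists (left_end i) => //; exact: left_end_mem.
  exists (left_end i); first exact: left_end_mem.
  exact: branch_left_end.
- apply: connected_continuous_connected; first exact: segment_connected.
  exact/continuous_subspaceT/branch_continuous.
- apply: connected_continuous_connected; first exact: segment_connected.
  exact/continuous_subspaceT/branch_continuous.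
Qed.

Lemma oval_piece_compact i : (i < 4)%N -> compact (oval_piece i).
Proof.
move=> i4; rewrite (oval_piece_branches i4).
by apply: compactU; apply: continuous_compact;
  [exact/continuous_subspaceT/branch_continuous|exact: segment_compact
  |exact/continuous_subspaceT/branch_continuous|exact: segment_compact].
Qed.

Lemma oval_piece_closed i : (i < 4)%N -> closed (oval_piece i).
Proof.
by move=> i4; apply: compact_closed; [exact: norm_hausdorff|exact: oval_piece_compact].
Qed.

Lemma oval_piece_nonempty i : (i < 4)%N -> oval_piece i !=set0.
Proof.
move=> i4; rewrite (oval_piece_branches i4).
exists (branch i 1 (left_end i)); left.
by exists (left_end i) => //; exact: left_end_mem.
Qed.

Lemma trivIset_oval_piece : trivIset `I_4 oval_piece.
Proof.
move=> i j /= i4 j4 [[x y] [[_ /= xi yi] [_ /= xj yj]]].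
move: i j i4 j4 xi xj yi yj; rewrite /left_end /right_end.
by move=> [|[|[|[|//]]]] [|[|[|[|//]]]] //= _ _ /andP[? ?] /andP[? ?];
  rewrite ?expr0 ?expr1 ?sqrrN ?expr1n ?exprS ?mulN1r ?mulr1 ?opprK ?mul1r;
  move=> ? ?; exfalso; lra.
Qed.

(** At y = 0 the equation reads [mid]^2 = [disc], so sqrt [disc] = |[mid]| >= [mid], against
    [sqrt_disc_lt]. *)
Lemma quartic_snd_neq0 p : quartic p -> p.2 != 0.
Proof.
move=> pq; have d0 : 0 <= disc p.1 by rewrite -pq sqr_ge0.
apply/eqP => y0; have := sqrt_disc_lt d0; rewrite -pq y0.
by rewrite expr0n mulr0 sub0r sqrtr_sqr normrN ltNge ler_norm.
Qed.

Lemma quartic_ovals : quartic = \bigcup_(i in `I_4) oval_piece i.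
Proof.
apply/seteqP; split=> [[x y] pq|p [i _ []] //].
have d0 : 0 <= disc x by rewrite -pq sqr_ge0.
have y_neq0 : y != 0 := quartic_snd_neq0 pq.
have : 0 < y \/ 0 < - y by rewrite oppr_gt0; apply/orP; rewrite orbC -neq_lt.
by move=> [y0|y0]; have /disc_ge0[xi|xi] := d0;
  [exists 0%N|exists 2%N|exists 1%N|exists 3%N] => //; split => //=;
  rewrite ?expr0 ?sqrrN ?expr1n ?expr1 ?[(-1) ^+ 3]exprS ?mulr1 ?mulN1r ?mul1r //
    sqrrN expr1n mulN1r.
Qed.

Lemma quartic_compact : compact quartic.
Proof.
rewrite quartic_ovals bigcup_mkord; apply: bigsetU_compact => i _.
exact: oval_piece_compact.
Qed.

Lemma quartic_consists_of_ovals : consists_of_ovals quartic 4.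
Proof.
split=> [|K]; rewrite quartic_ovals.
  exact: (card_components_bigcup (finite_II 4) oval_piece_nonempty
    oval_piece_connected oval_piece_closed trivIset_oval_piece).
move=> compK; split=> //; move: compK.
rewrite (components_bigcup (finite_II 4) oval_piece_nonempty
  oval_piece_connected oval_piece_closed trivIset_oval_piece) => -[i i4 <-].
exact: oval_piece_compact.
Qed.

(* The expression on the left of [!=] is minus the derivative of [disc]. *)
Lemma disc_simple_roots x : disc x = 0 ->
  (36 * (1512 * x - 55) + 1512 * (36 * x + 77)) * ((24 * x - 7) * (12 * x - 5)) +
  (36 * x + 77) * (1512 * x - 55) * (24 * (12 * x - 5) + 12 * (24 * x - 7)) != 0.
Proof.
rewrite /disc => /eqP; rewrite oppr_eq0 !mulf_eq0 -!orbA => root.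
have {root} : [\/ x = - (77 / 36), x = 55 / 1512, x = 7 / 24 | x = 5 / 12].
  by case/or4P: root => /eqP root;
    [constructor 1|constructor 2|constructor 3|constructor 4]; lra.
by case=> ->; apply/eqP; lra.
Qed.

End OvalGeometry.

(** * The polynomial: its hessian, the gradient of the hessian, and its degree *)

Section Polynomials.
Context (R : realType).
Implicit Types (f g : bipoly R) (p : R * R) (i j k : nat).

Definition varx : bipoly R := mpoly.mpolyX R (mpoly.mnm1 (ord0 : 'I_2)).
Definition vary : bipoly R := mpoly.mpolyX R (mpoly.mnm1 (ord_max : 'I_2)).

Lemma eval_atD f g p : eval_at (f + g) p = eval_at f p + eval_at g p.
Proof. exact: mevalD. Qed.

Lemma eval_atN f p : eval_at (- f) p = - eval_at f p.
Proof. exact: mevalN. Qed.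

Lemma eval_atM f g p : eval_at (f * g) p = eval_at f p * eval_at g p.
Proof. exact: mevalM. Qed.

Lemma eval_at_nat k p : eval_at k%:R p = k%:R.
Proof. by rewrite /eval_at mevalMn meval1. Qed.

Lemma eval_at_exp f k p : eval_at (f ^+ k) p = eval_at f p ^+ k.
Proof. by rewrite /eval_at rmorphXn. Qed.

Lemma eval_varx p : eval_at varx p = p.1.
Proof. exact: mevalXU. Qed.

Lemma eval_vary p : eval_at vary p = p.2.
Proof. exact: mevalXU. Qed.

Definition eval_atE := (eval_at_nat, eval_varx, eval_vary, eval_atD, eval_atN,
  eval_at_exp, eval_atM).

Lemma mderiv_nat (i : 'I_2) k : mpoly.mderiv i (k%:R : bipoly R) = 0.
Proof. by rewrite -mpolyC_nat mderivC. Qed.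

Lemma mderiv_exp (i : 'I_2) f k :
  mpoly.mderiv i (f ^+ k) = k%:R * f ^+ k.-1 * mpoly.mderiv i f.
Proof.
elim: k => [|k IHk]; first by rewrite expr0 (mderiv_nat _ 1) mul0r mul0r.
(* [f * f ^+ k.-1] is [f ^+ k] only for positive [k]; at 0 the coefficient [k%:R] kills the term. *)
rewrite exprS mderivM IHk /=; case: k {IHk} => [|k] /=; first by rewrite !expr0; ring.
by rewrite exprS -!natr1; ring.
Qed.

Lemma dx_varx : dx varx = 1.
Proof.
rewrite /dx mderivX mnm1E eqxx scale1r -[X in mnm_sub X _]add0m.
by rewrite addmK mpolyX0.
Qed.

Lemma dy_vary : dy vary = 1.
Proof.
rewrite /dy mderivX mnm1E eqxx scale1r -[X in mnm_sub X _]add0m.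
by rewrite addmK mpolyX0.
Qed.

Lemma dx_vary : dx vary = 0.
Proof. by rewrite /dx mderivX mnm1E scale0r. Qed.

Lemma dy_varx : dy varx = 0.
Proof. by rewrite /dy mderivX mnm1E scale0r. Qed.

Lemma dxD f g : dx (f + g) = dx f + dx g. Proof. exact: mderivD. Qed.
Lemma dyD f g : dy (f + g) = dy f + dy g. Proof. exact: mderivD. Qed.
Lemma dxN f : dx (- f) = - dx f. Proof. exact: mderivN. Qed.
Lemma dyN f : dy (- f) = - dy f. Proof. exact: mderivN. Qed.
Lemma dxM f g : dx (f * g) = dx f * g + f * dx g. Proof. exact: mderivM. Qed.
Lemma dyM f g : dy (f * g) = dy f * g + f * dy g. Proof. exact: mderivM. Qed.
Lemma dx_nat k : dx (k%:R : bipoly R) = 0. Proof. exact: mderiv_nat. Qed.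
Lemma dy_nat k : dy (k%:R : bipoly R) = 0. Proof. exact: mderiv_nat. Qed.
Lemma dx_exp f k : dx (f ^+ k) = k%:R * f ^+ k.-1 * dx f.
Proof. exact: mderiv_exp. Qed.
Lemma dy_exp f k : dy (f ^+ k) = k%:R * f ^+ k.-1 * dy f.
Proof. exact: mderiv_exp. Qed.

Definition dxE := (dx_nat, dx_varx, dx_vary, dxD, dxN, dx_exp, dxM).
Definition dyE := (dy_nat, dy_varx, dy_vary, dyD, dyN, dy_exp, dyM).

(** 1080 times the f of the overview; the terms in x alone are 1080 g, where g'' = H. *)
Definition quartic_fun : bipoly R :=
  180 * vary ^+ 4 - 1080 * (varx ^+ 2 * vary ^+ 2) - 1080 * vary ^+ 2
  + 1188 * varx ^+ 4 - 2108 * varx ^+ 3 + 1465 * varx ^+ 2.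

Lemma Hess_quartic_fun : Hess quartic_fun =
  - ((2160 * vary ^+ 2 - (3888 * varx ^+ 2 - 6324 * varx + 2545)) ^+ 2 +
     (36 * varx + 77) * (1512 * varx - 55) * ((24 * varx - 7) * (12 * varx - 5))).
Proof.
have fx : dx quartic_fun = 4752 * varx ^+ 3 - 6324 * varx ^+ 2 + 2930 * varx
    - 2160 * (varx * vary ^+ 2).
  by rewrite /quartic_fun !dxE /=; ring.
have fy : dy quartic_fun =
    720 * vary ^+ 3 - 2160 * (varx ^+ 2 * vary) - 2160 * vary.
  by rewrite /quartic_fun !dyE /=; ring.
have fxx : dx (dx quartic_fun) =
    14256 * varx ^+ 2 - 12648 * varx + 2930 - 2160 * vary ^+ 2.
  by rewrite fx !dxE /=; ring.
have fxy : dy (dx quartic_fun) = - (4320 * (varx * vary)).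
  by rewrite fx !dyE /=; ring.
have fyy : dy (dy quartic_fun) = 2160 * (vary ^+ 2 - varx ^+ 2 - 1).
  by rewrite fy !dyE /=; ring.
by rewrite /Hess fxx fyy fxy; ring.
Qed.

Lemma eval_Hess p : eval_at (Hess quartic_fun) p =
  - ((2160 * p.2 ^+ 2 - mid p.1) ^+ 2 - disc p.1).
Proof. by rewrite Hess_quartic_fun !eval_atE /mid /disc; ring. Qed.

Lemma curve_Hess : curve (Hess quartic_fun) = @quartic R.
Proof.
apply/seteqP; split=> p; rewrite /curve /quartic /= eval_Hess => /eqP.
  by rewrite oppr_eq0 subr_eq0 => /eqP.
by rewrite -subr_eq0 => /eqP ->; rewrite oppr0.
Qed.

(** Differentiating with abstract factors preserves the factored shape of the hessian in its
    gradient. *)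
Lemma eval_dx_sqrDprod m u v w z p :
  eval_at (dx (- (m ^+ 2 + u * v * (w * z)))) p =
  - (2 * eval_at m p * eval_at (dx m) p +
     ((eval_at (dx u) p * eval_at v p + eval_at (dx v) p * eval_at u p) *
        (eval_at w p * eval_at z p) +
      eval_at u p * eval_at v p *
        (eval_at (dx w) p * eval_at z p + eval_at (dx z) p * eval_at w p))).
Proof. by rewrite dxN dxD dx_exp !dxM !eval_atE /=; ring. Qed.

Lemma eval_dy_sqrDprod m u v w z p :
  dy u = 0 -> dy v = 0 -> dy w = 0 -> dy z = 0 ->
  eval_at (dy (- (m ^+ 2 + u * v * (w * z)))) p =
  - (2 * eval_at m p * eval_at (dy m) p).
Proof.
move=> u0 v0 w0 z0; rewrite dyN dyD dy_exp !dyM u0 v0 w0 z0.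
by rewrite !(mul0r, mulr0, addr0) !eval_atE /=; ring.
Qed.

(** The first component is arranged to contain verbatim the expression of [disc_simple_roots]. *)
Lemma gradient_Hess p : gradient (Hess quartic_fun) p =
  (- (2 * (2160 * p.2 ^+ 2 - mid p.1) * (6324 - 7776 * p.1) +
      ((36 * (1512 * p.1 - 55) + 1512 * (36 * p.1 + 77)) *
         ((24 * p.1 - 7) * (12 * p.1 - 5)) +
       (36 * p.1 + 77) * (1512 * p.1 - 55) *
         (24 * (12 * p.1 - 5) + 12 * (24 * p.1 - 7)))),
   - (2 * (2160 * p.2 ^+ 2 - mid p.1) * (4320 * p.2))).
Proof.
have affx a b : dx (a%:R * varx + b%:R) = a%:R by rewrite !dxE; ring.
have affNx a b : dx (a%:R * varx - b%:R) = a%:R by rewrite !dxE; ring.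
have affy a b : dy (a%:R * varx + b%:R) = 0 by rewrite !dyE; ring.
have affNy a b : dy (a%:R * varx - b%:R) = 0 by rewrite !dyE; ring.
have evaff a b : eval_at (a%:R * varx + b%:R) p = a%:R * p.1 + b%:R.
  by rewrite !eval_atE.
have evaffN a b : eval_at (a%:R * varx - b%:R) p = a%:R * p.1 - b%:R.
  by rewrite !eval_atE.
rewrite /gradient Hess_quartic_fun.
set m := 2160 * vary ^+ 2 - _.
have evdxm : eval_at (dx m) p = 6324 - 7776 * p.1.
  have -> : dx m = - (7776 * varx - 6324) by rewrite !dxE /=; ring.
  by rewrite eval_atN evaffN opprB.
have evdym : eval_at (dy m) p = 4320 * p.2.
  have -> : dy m = 4320 * vary by rewrite !dyE /=; ring.
  by rewrite eval_atM eval_at_nat eval_vary.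
have evm : eval_at m p = 2160 * p.2 ^+ 2 - mid p.1 by rewrite !eval_atE.
rewrite eval_dx_sqrDprod affx !affNx eval_dy_sqrDprod ?affNy //.
rewrite evaff !evaffN evm evdxm evdym !eval_at_nat.
by [].
Qed.

(** Since y is nonzero on the curve, a vanishing y-derivative forces 2160 y^2 = [mid], hence [disc]
    = 0; the x-derivative is then the derivative of [disc] at a simple root. *)
Lemma smooth_Hess : smooth_curve (Hess quartic_fun).
Proof.
move=> p; rewrite curve_Hess gradient_Hess => pq [gx0 gy0].
have y_neq0 := quartic_snd_neq0 pq.
have m0 : 2160 * p.2 ^+ 2 - mid p.1 = 0.
  have {gy0} /eqP : (2160 * p.2 ^+ 2 - mid p.1) * p.2 = 0 by lra.
  by rewrite mulf_eq0 (negbTE y_neq0) orbF => /eqP.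
have d0 : disc p.1 = 0 by rewrite -pq m0 expr0n.
have /eqP := disc_simple_roots d0; apply.
by move/eqP: gx0; rewrite m0 mulr0 mul0r add0r oppr_eq0 => /eqP.
Qed.

(** Every monomial has degree at most 4, and y^4 has the nonzero coefficient 180. *)
Lemma quartic_fun_degree : has_degree quartic_fun 4.
Proof.
pose X (i : 'I_2) k := mnm_muln (mpoly.mnm1 i) k.
have xX k : varx ^+ k = mpoly.mpolyX R (X ord0 k) by exact: mpolyXn.
have yX k : vary ^+ k = mpoly.mpolyX R (X ord_max k) by exact: mpolyXn.
have degX (i : 'I_2) k : mpoly.mdeg (X i k) = k by rewrite mdegMn mdeg1 mul1n.
pose size_le5 g := (mpoly.mmeasure mpoly.mdeg g <= 5)%N.
have size_monomial (m : mpoly.multinom 2) k : (mpoly.mdeg m <= 4)%N ->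
    size_le5 (k%:R * mpoly.mpolyX R m).
  move=> m4; rewrite mulr_natl -scaler_nat.
  by apply: leq_trans (msizeZ_le _ _) _; rewrite msizeX.
have sizeD f g : size_le5 f -> size_le5 g -> size_le5 (f + g).
  by move=> f5 g5; apply: leq_trans (msizeD_le _ _) _; rewrite geq_max; apply/andP.
have sizeB f g : size_le5 f -> size_le5 g -> size_le5 (f - g).
  by move=> f5 g5; apply: sizeD; rewrite // /size_le5 msizeN.
have coefX k (m : mpoly.multinom 2) :
    mpoly.mcoeff m (k%:R * mpoly.mpolyX R m) = k%:R.
  by rewrite mulr_natl mcoeffMn mcoeffX eqxx.
have coef0 k (m m' : mpoly.multinom 2) (i : 'I_2) : m i != m' i ->
    mpoly.mcoeff m' (k%:R * mpoly.mpolyX R m) = 0.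
  move=> mi; rewrite mulr_natl mcoeffMn mcoeffX.
  by have [mm'|] := eqVneq m m'; [rewrite mm' eqxx in mi|rewrite mul0rn].
have valX (i j : 'I_2) k : X i k j = ((i == j) * k)%N by rewrite mulmnE mnm1E.
have mixedX : mnm_add (X ord0 2%N) (X ord_max 2%N) ord0 = 2%N.
  by rewrite mnmDE !valX.
rewrite /has_degree /quartic_fun !xX !yX -mpolyXD.
apply/eqP; rewrite eqn_leq; apply/andP; split.
  apply: (sizeD _ _); [apply: (sizeB _ _); [apply: (sizeD _ _);
    [apply: (sizeB _ _); [apply: (sizeB _ _)|]|]|]|];
  by apply: (size_monomial _ _); rewrite ?degX // mdegD !degX.
suff /msize_mdeg_lt : X ord_max 4%N \in mpoly.msupp quartic_fun.
  by rewrite degX /quartic_fun !xX !yX -mpolyXD.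
rewrite mcoeff_msupp /quartic_fun !xX !yX -mpolyXD !(mcoeffD, mcoeffN) coefX.
(* The monomials involving x differ from y^4 in the exponent of x, and y^2 differs from it in the
   exponent of y. *)
rewrite !(@coef0 _ (X ord0 _) _ ord0) ?valX //.
rewrite (@coef0 _ (mnm_add _ _) _ ord0) ?mixedX ?valX //.
by rewrite (@coef0 _ (X ord_max 2%N) _ ord_max) ?valX.
Qed.

End Polynomials.

Theorem theorem2 (R : realType) :
  exists f : bipoly R,
    [/\ has_degree f 4,
        smooth_curve (Hess f),
        compact (curve (Hess f))
      & consists_of_ovals (curve (Hess f)) 4].
Proof.
exists (quartic_fun R); split; first exact: quartic_fun_degree.
- exact: smooth_Hess.
- by rewrite curve_Hess; exact: quartic_compact.
- by rewrite curve_Hess; exact: quartic_consists_of_ovals.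
Qed.
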